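(* For a nondegenerate model of walk, the rational maps $\iota_1,\iota_2:\overline{E_t}\dashrightarrow\overline{E_t}$ can be extended into involutive automorphisms of the algebraic curve $\overline{E_t}$.
   Context: Weights: $d_{i,j}\in[0,1]$ for $(i,j)\in\{-1,0,1\}^2$, with $\sum d_{i,j}=1$; $t\in\,]0,1[$ is fixed and transcendental over $\mathbb{Q}(d_{i,j})$. Let $S(x,y)=\sum_{i,j}d_{i,j}x^iy^j$ and $K(x,y,t)=xy(1-tS(x,y))\in\mathbb{C}[x,y]$. The model is degenerate if $K(x,y,t)$ is reducible in $\mathbb{C}[x,y]$, or has $x$-degree $\le 1$, or has $y$-degree $\le 1$; otherwise it is nondegenerate. The kernel curve is $\overline{E_t}=\{([x_0:x_1],[y_0:y_1])\in\mathbb{P}^1(\mathbb{C})\times\mathbb{P}^1(\mathbb{C}) : \overline{K}(x_0,x_1,y_0,y_1,t)=0\}$ with $\overline{K}=x_0x_1y_0y_1-t\sum_{i,j=0}^2 d_{i-1,j-1}x_0^ix_1^{2-i}y_0^jy_1^{2-j}$. Write $S(x,y)=A_{-1}(x)\frac1y+A_0(x)+A_1(x)y=B_{-1}(y)\frac1x+B_0(y)+B_1(y)x$. The rational maps $\iota_1,\iota_2:\overline{E_t}\dashrightarrow\overline{E_t}$ are given, where the denominators do not vanish, by $$\iota_1([x_0:x_1],[y_0:y_1])=\left([x_0:x_1],\left[\frac{A_{-1}(x_0/x_1)}{A_1(x_0/x_1)\,\frac{y_0}{y_1}}:1\right]\right),$$ $$\iota_2([x_0:x_1],[y_0:y_1])=\left(\left[\frac{B_{-1}(y_0/y_1)}{B_1(y_0/y_1)\,\frac{x_0}{x_1}}:1\right],[y_0:y_1]\right).$$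 An endomorphism of $\overline{E_t}$ is a rational map $\overline{E_t}\dashrightarrow\overline{E_t}$ that is regular at every point $P$, i.e. it can be represented in suitable affine charts containing $P$ and its image by a rational function with nonvanishing denominator at $P$; this includes the possible singular points of $\overline{E_t}$. An automorphism is an endomorphism with an inverse endomorphism. *)

(* Defs.v *)
From HB Require Import structures.
From mathcomp Require Import all_boot all_order all_algebra generic_quotient polyXY.
From mathcomp Require Import classical_sets boolp cardinality reals.
From mathcomp Require Import complex ring.

Set Implicit Arguments.
Unset Strict Implicit.
Unset Printing Implicit Defensive.

Import Order.TTheory GRing.Theory Num.Theory.
Local Open Scope ring_scope.
Local Open Scope complex_scope.
Local Open Scope quotient_scope.
Local Open Scope classical_set_scope.

(* The subfield generated by A: 'divring_closed' is closure under 1, -, /. *)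
Definition subfield_gen (F : fieldType) (A : set F) : set F :=
  smallest (fun S : set F => divring_closed (mem S)) A.

Definition transcendental_over (F : fieldType) (k : set F) (t : F) : Prop :=
  forall p : {poly F}, p != 0 -> (forall i, k p`_i) -> ~~ root p t.

(* F[x,y] is {poly {poly F}} with the conventions of polyXY: x is the outer
   variable 'X, y is the inner variable 'Y, and p.[x, y] is evaluation. *)
Definition reducible (F : fieldType) (p : {poly {poly F}}) : Prop :=
  exists q r : {poly {poly F}},
    [/\ p = q * r, q \isn't a GRing.unit & r \isn't a GRing.unit].

(* 'size' and 'sizeY' are 1 + the degrees in x and in y. *)
Definition degenerate (F : fieldType) (p : {poly {poly F}}) : Prop :=
  [\/ reducible p, (size p <= 2)%N | (sizeY p <= 2)%N].

Section ProjectiveLine.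
Variable F : fieldType.

Definition hcoord : Type := {v : F * F | v != 0}.
HB.instance Definition _ := Choice.on hcoord.

Definition proportional (v w : hcoord) : bool :=
  (val v).1 * (val w).2 == (val v).2 * (val w).1.

Lemma proportional_refl : reflexive proportional.
Proof. by move=> v; rewrite /proportional mulrC. Qed.

Lemma proportional_sym : symmetric proportional.
Proof.
by move=> v w; rewrite /proportional eq_sym mulrC [X in _ == X]mulrC.
Qed.

Lemma proportionalP (v w : hcoord) :
  reflect (exists2 c, c != 0 & val w = (c * (val v).1, c * (val v).2))
          (proportional v w).
Proof.
case: v w => [[v1 v2] /= nv] [[w1 w2] /= nw]; rewrite /proportional /=.
apply: (iffP eqP) => [E|[c _ [-> ->]]]; last by rewrite mulrCA [RHS]mulrCA (mulrC v1).
have [v10|v1n] := eqVneq v1 0.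
  have v2n : v2 != 0 by apply: contraNneq nv => v20; rewrite v10 v20.
  have w10 : w1 = 0.
    by apply/eqP; move/esym/eqP: E; rewrite v10 mul0r mulf_eq0 (negPf v2n).
  have w2n : w2 != 0 by apply: contraNneq nw => w20; rewrite w10 w20.
  exists (w2 / v2); first by rewrite mulf_neq0 ?invr_eq0.
  by rewrite v10 w10 mulr0 divfK.
have w2E : w2 = v2 * w1 / v1 by rewrite -E mulrC mulKf.
have w1n : w1 != 0.
  by apply: contraNneq nw => w10; rewrite w2E w10 mulr0 mul0r.
exists (w1 / v1); first by rewrite mulf_neq0 ?invr_eq0.
by congr (_, _); first field; rewrite // w2E; field.
Qed.

Lemma proportional_trans : transitive proportional.
Proof.
move=> v u w /proportionalP [c c0 Ev] /proportionalP [e e0 Ew].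
apply/proportionalP; exists (e * c); first by rewrite mulf_neq0.
by rewrite Ew Ev /= !mulrA.
Qed.

Canonical proportional_equiv :=
  EquivRel proportional proportional_refl proportional_sym proportional_trans.

Definition P1 : Type := {eq_quot proportional}.
HB.instance Definition _ := EqQuotient.on P1.
HB.instance Definition _ := Choice.on P1.

(* [v.1 : v.2] *)
Definition P1pt (v : F * F) (nv : v != 0) : P1 :=
  \pi_{eq_quot proportional} (exist _ v nv).

Lemma affine_neq0 (z : F) : (z, 1 : F) != 0.
Proof. by rewrite xpair_eqE oner_eq0 andbF. Qed.

(* [z : 1] *)
Definition P1affine (z : F) : P1 := P1pt (affine_neq0 z).

(* Homogeneous coordinates of a chosen representative. *)
Definition hc0 (p : P1) : F := (val (repr p : hcoord)).1.
Definition hc1 (p : P1) : F := (val (repr p : hcoord)).2.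

Lemma P1pt_hc (v : F * F) (nv : v != 0) :
  exists2 c, c != 0 & v = (c * hc0 (P1pt nv), c * hc1 (P1pt nv)).
Proof.
have /eqmodP/= /proportionalP [c c0 E] :
    repr (P1pt nv) = exist _ v nv %[mod {eq_quot proportional}].
  by rewrite reprK.
by exists c.
Qed.

(* The two standard affine charts of P^1: x1 <> 0 with coordinate x0/x1
   (b = false), and x0 <> 0 with coordinate x1/x0 (b = true). *)
Definition in_chart1 (b : bool) (p : P1) : bool :=
  if b then hc0 p != 0 else hc1 p != 0.
Definition coord1 (b : bool) (p : P1) : F :=
  if b then hc1 p / hc0 p else hc0 p / hc1 p.

(* The four standard affine charts of P^1 x P^1. *)
Definition in_chart (c : bool * bool) (P : P1 * P1) : bool :=
  in_chart1 c.1 P.1 && in_chart1 c.2 P.2.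
Definition chart_eval (c : bool * bool) (p : {poly {poly F}}) (P : P1 * P1) : F :=
  p.[coord1 c.1 P.1, coord1 c.2 P.2].

Section Curve.
Variable E : pred (P1 * P1).
Local Notation curve := {P : P1 * P1 | E P}.

(* phi is given, on the neighbourhood of P in E cut out by the chart c and
   g1, g2 <> 0, by (f1/g1, f2/g2) in the chart c' containing phi P. *)
Definition regular_at (phi : curve -> curve) (P : curve) : Prop :=
  exists (c c' : bool * bool) (f1 g1 f2 g2 : {poly {poly F}}),
    [/\ in_chart c (val P),
        in_chart c' (val (phi P)),
        chart_eval c g1 (val P) != 0,
        chart_eval c g2 (val P) != 0 &
        forall Q : curve, in_chart c (val Q) ->
          chart_eval c g1 (val Q) != 0 -> chart_eval c g2 (val Q) != 0 ->
          [/\ in_chart c' (val (phi Q)),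
              coord1 c'.1 (val (phi Q)).1
                = chart_eval c f1 (val Q) / chart_eval c g1 (val Q) &
              coord1 c'.2 (val (phi Q)).2
                = chart_eval c f2 (val Q) / chart_eval c g2 (val Q)]].

Definition endomorphism (phi : curve -> curve) : Prop :=
  forall P : curve, regular_at phi P.

Definition automorphism (phi : curve -> curve) : Prop :=
  endomorphism phi /\
  exists psi : curve -> curve,
    [/\ endomorphism psi, cancel phi psi & cancel psi phi].

(* phi extends the rational map from E to E given by the formula f wherever
   dom holds. On an irreducible curve, the dense open sets are the complements
   of finite sets; without the first clause an f defined nowhere on E would be
   extended by every phi. *)
Definition extends_rational_map (phi : curve -> curve)
    (dom : pred (P1 * P1)) (f : P1 * P1 -> P1 * P1) : Prop :=
  finite_set [set P : curve | ~~ dom (val P)] /\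
  forall P : curve, dom (val P) -> val (phi P) = f (val P).

End Curve.
End ProjectiveLine.

Section Walk.
Variables (R : realType) (d : 'I_3 -> 'I_3 -> R) (t : R).
Local Notation C := R[i].

(* The weight of the step (k, l) in {-1,0,1}^2 is d (k + 1) (l + 1). *)
Definition step (i : 'I_3) : int := i%:Z - 1.

Definition S_ (x y : C) : C :=
  \sum_(i < 3) \sum_(j < 3) (d i j)%:C * x ^ step i * y ^ step j.

(* A_ ord0 and A_ ord_max are A_{-1} and A_1, and likewise for B_. *)
Definition A_ (j : 'I_3) (x : C) : C := \sum_(i < 3) (d i j)%:C * x ^ step i.
Definition B_ (i : 'I_3) (y : C) : C := \sum_(j < 3) (d i j)%:C * y ^ step j.

Lemma S_A (x y : C) : S_ x y = \sum_(j < 3) A_ j x * y ^ step j.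
Proof.
by rewrite /S_ exchange_big; apply: eq_bigr => j _; rewrite mulr_suml.
Qed.

Lemma S_B (x y : C) : S_ x y = \sum_(i < 3) B_ i y * x ^ step i.
Proof.
rewrite /S_; apply: eq_bigr => i _; rewrite mulr_suml.
by apply: eq_bigr => j _; rewrite mulrAC.
Qed.

Definition kernel : {poly {poly C}} :=
  'X * 'Y - (t%:C)%:P%:P *
    \sum_(i < 3) \sum_(j < 3) ((d i j)%:C)%:P%:P * 'X ^+ i * 'Y ^+ j.

Lemma kernelE (x y : C) : x != 0 -> y != 0 ->
  kernel.[x, y] = x * y * (1 - t%:C * S_ x y).
Proof.
move=> x0 y0.
have XE (z : C) (i : 'I_3) : z != 0 -> z ^+ i = z * z ^ step i.
  move=> z0; rewrite /step -[X in X * _]expr1z -expfzDr //.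
  by rewrite addrCA subrr addr0.
rewrite /kernel hornerD hornerN hornerM hornerX hornerC hornerM hornerC.
rewrite hornerD hornerN !hornerM hornerX !hornerC mulrBr mulr1; congr (_ - _).
rewrite mulrCA; congr (_ * _).
rewrite /S_ !horner_sum mulr_sumr; apply: eq_bigr => i _.
rewrite !horner_sum mulr_sumr; apply: eq_bigr => j _.
rewrite !hornerM hornerC !horner_exp hornerX hornerC.
rewrite !hornerC ?hornerX ?hornerM (XE _ i x0) (XE _ j y0).
by ring.
Qed.

Definition Kbar (x0 x1 y0 y1 : C) : C :=
  x0 * x1 * y0 * y1 - t%:C *
    \sum_(i < 3) \sum_(j < 3)
      (d i j)%:C * x0 ^+ i * x1 ^+ (2 - i) * y0 ^+ j * y1 ^+ (2 - j).

Definition kernel_curve (P : P1 C * P1 C) : bool :=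
  Kbar (hc0 P.1) (hc1 P.1) (hc0 P.2) (hc1 P.2) == 0.

Lemma Kbar_scale (a b x0 x1 y0 y1 : C) :
  Kbar (a * x0) (a * x1) (b * y0) (b * y1)
  = a ^+ 2 * b ^+ 2 * Kbar x0 x1 y0 y1.
Proof.
by rewrite /Kbar !big_ord_recr !big_ord0 /=; ring.
Qed.

Lemma kernel_curveE (v w : C * C) (nv : v != 0) (nw : w != 0) :
  kernel_curve (P1pt nv, P1pt nw) = (Kbar v.1 v.2 w.1 w.2 == 0).
Proof.
have [a a0 Ev] := P1pt_hc nv; have [b b0 Ew] := P1pt_hc nw.
rewrite [v in RHS]Ev [w in RHS]Ew /= Kbar_scale /kernel_curve /=.
by rewrite !mulf_eq0 (negPf a0) (negPf b0).
Qed.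

(* The quantities x0/x1 and y0/y1, and the formulas defining the involutions,
   are used only where every denominator, including those of the Laurent
   polynomials A_ and B_, is nonzero. *)
Definition ratio (p : P1 C) : C := hc0 p / hc1 p.

Definition nonzero_coords (P : P1 C * P1 C) : bool :=
  [&& hc0 P.1 != 0, hc1 P.1 != 0, hc0 P.2 != 0 & hc1 P.2 != 0].

Definition iota1_dom (P : P1 C * P1 C) : bool :=
  nonzero_coords P && (A_ ord_max (ratio P.1) != 0).
Definition iota1 (P : P1 C * P1 C) : P1 C * P1 C :=
  (P.1, P1affine (A_ ord0 (ratio P.1) / (A_ ord_max (ratio P.1) * ratio P.2))).

Definition iota2_dom (P : P1 C * P1 C) : bool :=
  nonzero_coords P && (B_ ord_max (ratio P.2) != 0).
Definition iota2 (P : P1 C * P1 C) : P1 C * P1 C :=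
  (P1affine (B_ ord0 (ratio P.2) / (B_ ord_max (ratio P.2) * ratio P.1)), P.2).

End Walk.

(* Main.v *)
Require Import Defs.
From mathcomp Require Import all_boot all_order all_algebra.
From mathcomp Require Import classical_sets reals complex.
From mathcomp Require Import polyXY boolp cardinality ring.

(** Above a point x of the first factor the kernel curve is cut out by a binary
    quadratic form a y0^2 + b y0 y1 + c y1^2 in [y0:y1], whose coefficients are
    forms of degree 2 in x.  If a, b and c had a common zero, the kernel would
    have a factor X - x, or x-degree at most 1 when x = [1:0]; nondegeneracy
    rules this out.  Every fibre therefore consists of exactly two points
    counted with multiplicity, and the involution exchanges them.

    The second root y' is characterised by Viete's relations, in the homogeneous
    form (a : -b : c) = (y1 y1' : y0 y1' + y1 y0' : y0 y0') that [splits]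
    expresses.  These determine y' and are symmetric in y and y', so the
    exchange is well defined and involutive.  The product of the roots gives
    y' = c / (a y), the formula for iota_1, but it is indeterminate when a or c
    vanishes.  The sum of the roots gives instead

      y' = [- b - a y : a]      with y = y0 / y1, where y1 is nonzero,
      y' = [c : - b - c w]      with w = y1 / y0, where y0 is nonzero,

    and these vectors never vanish on the curve ([splits_residual],
    [splits_neq0]).  Their entries are polynomials in the chart coordinates, and
    dividing by a nonzero one shows that the map is regular at every point,
    whether the curve is singular there or not ([fibre_involution_endo]).

    The formula for iota_1 is undefined only over finitely many x and finitely
    many y, and fibres are finite, because no line lies in the curve.

    For iota_2, transpose the weights: this exchanges the two factors of
    P^1 x P^1, preserves nondegeneracy, and turns iota_1 into iota_2. *)

Set Implicit Arguments.
Unset Strict Implicit.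
Unset Printing Implicit Defensive.

Import Order.TTheory GRing.Theory Num.Theory.
Local Open Scope ring_scope.
Local Open Scope classical_set_scope.

(** * Residual roots of binary quadratic forms *)

Section BinaryQuadraticForm.
Variable F : fieldType.
Implicit Types (a b c k : F) (w : F * F).

Definition qform a b c w : F := a * w.1 ^+ 2 + b * (w.1 * w.2) + c * w.2 ^+ 2.

(** The form a Y0^2 + b Y0 Y1 + c Y1^2 is a nonzero multiple of
    (Y0 w_2 - Y1 w_1) (Y0 w'_2 - Y1 w'_1), where w = (w_1, w_2). *)
Definition splits a b c w w' : Prop := exists2 k, k != 0 &
  [/\ a = k * (w.2 * w'.2), b = - (k * (w.1 * w'.2 + w.2 * w'.1))
    & c = k * (w.1 * w'.1)].

(** The second root, obtained from the sum of the roots in each chart: for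
    w = (y, 1) it is [-b - a y : a], and for w = (1, z) it is [c : -b - c z].
    The boolean follows the convention for charts: true when the first
    coordinate is the one divided by. *)
Definition residual a b c (h : bool) w : F * F :=
  if h then (c * w.1, - (b * w.1 + c * w.2))
  else (- (b * w.2 + a * w.1), a * w.2).

Lemma pair_neq0 (w : F * F) : (w != 0) = (w.1 != 0) || (w.2 != 0).
Proof. by case: w => w1 w2; rewrite xpair_eqE negb_and. Qed.

Lemma splits_sym a b c w w' : splits a b c w w' -> splits a b c w' w.
Proof. by move=> [k k0 [-> -> ->]]; exists k => //; split; ring. Qed.

Lemma splits_qform a b c w w' : splits a b c w w' -> qform a b c w' = 0.
Proof. by move=> [k k0 [-> -> ->]]; rewrite /qform; ring. Qed.

Lemma splits_scale a b c w w' r s s' : r != 0 -> s != 0 -> s' != 0 ->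
  splits a b c w w' ->
  splits (r * a) (r * b) (r * c) (s * w.1, s * w.2) (s' * w'.1, s' * w'.2).
Proof.
move=> r0 s0 s'0 [k k0 [-> -> ->]]; exists (r * k / (s * s')) => /=.
  by rewrite !mulf_neq0 ?invr_eq0 ?mulf_neq0.
by split; field; rewrite ?s0 ?s'0.
Qed.

Lemma splits_residual a b c h w :
  (if h then w.1 else w.2) != 0 -> qform a b c w = 0 ->
  splits a b c w (residual a b c h w).
Proof.
rewrite /qform /residual; case: h => /= w0 q0.
  exists (w.1 ^- 2); first by rewrite invr_eq0 expf_neq0.
  split=> /=; [|by field|by field].
  apply: (mulfI (expf_neq0 2 w0)); rewrite mulVKf ?expf_neq0 //.
  by rewrite -[LHS]subr0 -q0; ring.
exists (w.2 ^- 2); first by rewrite invr_eq0 expf_neq0.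
split=> /=; [by field|by field|].
apply: (mulfI (expf_neq0 2 w0)); rewrite mulVKf ?expf_neq0 //.
by rewrite -[LHS]subr0 -q0; ring.
Qed.

(** This is what makes the formulas of [residual] usable as homogeneous
    coordinates: by the factorisation, w' = 0 would kill the whole form. *)
Lemma splits_neq0 a b c w w' :
  [|| a != 0, b != 0 | c != 0] -> splits a b c w w' -> w' != 0.
Proof.
move=> nz [k _ [Ea Eb Ec]]; apply: contraTneq nz => w'0.
by rewrite Ea Eb Ec w'0 /= !mulr0 addr0 mulr0 oppr0 eqxx.
Qed.

(** Unique factorisation of the form: once the linear factor of w is removed,
    the other factor is determined up to a scalar. *)
Lemma splits_uniq a b c w w' w'' : w != 0 ->
  splits a b c w w' -> splits a b c w w'' -> w'.1 * w''.2 = w'.2 * w''.1.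
Proof.
move=> w0 [k k0 [-> -> ->]] [l l0 [Ea /oppr_inj Eb Ec]].
move: w0; rewrite pair_neq0 => /orP[w10|w20].
  have E1 : k * w'.1 = l * w''.1.
    by apply: (mulfI w10); rewrite mulrCA Ec mulrCA.
  have E2 : k * w'.2 = l * w''.2.
    apply: (mulfI w10); apply: (addIr (w.2 * (k * w'.1))).
    by rewrite [in RHS]E1; move: Eb; rewrite !mulrDr !(mulrCA k) !(mulrCA l).
  apply: (mulfI k0); apply: (mulfI l0).
  transitivity ((k * w'.1) * (l * w''.2)); first by ring.
  by rewrite E1 -E2; ring.
have E2 : k * w'.2 = l * w''.2.
  by apply: (mulfI w20); rewrite mulrCA Ea mulrCA.
have E1 : k * w'.1 = l * w''.1.
  apply: (mulfI w20); apply: (addrI (w.1 * (k * w'.2))).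
  by rewrite [in RHS]E2; move: Eb; rewrite !mulrDr !(mulrCA k) !(mulrCA l).
apply: (mulfI k0); apply: (mulfI l0).
transitivity ((k * w'.1) * (l * w''.2)); first by ring.
by rewrite E1 -E2; ring.
Qed.

Lemma splits_root a b c w w' v : splits a b c w w' -> qform a b c v = 0 ->
  v.1 * w.2 = v.2 * w.1 \/ v.1 * w'.2 = v.2 * w'.1.
Proof.
move=> [k k0 [-> -> ->]] qv.
have /eqP : k * ((v.1 * w.2 - v.2 * w.1) * (v.1 * w'.2 - v.2 * w'.1)) = 0.
  by rewrite -qv /qform; ring.
by rewrite !mulf_eq0 (negPf k0) !subr_eq0 /= => /orP[] /eqP; [left|right].
Qed.

End BinaryQuadraticForm.

(** * Points of the projective line *)

Section Points.
Variable F : fieldType.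
Implicit Types (p : P1 F) (v w : F * F).

Definition hc p : F * F := (hc0 p, hc1 p).

Lemma hc_neq0 p : hc p != 0.
Proof. by rewrite /hc /hc0 /hc1 -surjective_pairing; exact: (valP (repr p : hcoord F)). Qed.

Lemma P1pt_eq v w (nv : v != 0) (nw : w != 0) :
  v.1 * w.2 = v.2 * w.1 -> P1pt nv = P1pt nw.
Proof. by move=> E; apply/eqmodP; rewrite /= /proportional /= E. Qed.

Lemma P1pt_hcK p : P1pt (hc_neq0 p) = p.
Proof.
rewrite -[RHS]reprK; apply/eqmodP => /=.
by rewrite /proportional /= mulrC.
Qed.

Lemma P1_eq p q : hc0 p * hc1 q = hc1 p * hc0 q -> p = q.
Proof. by move=> E; rewrite -(P1pt_hcK p) -(P1pt_hcK q); apply: P1pt_eq. Qed.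

(** With coord1 h p as second argument, homogeneous coordinates of p that depend
    polynomially on the coordinate of p in the chart h. *)
Definition affine_vec (h : bool) (z : F) : F * F := if h then (1, z) else (z, 1).

Lemma hc_chart h p : in_chart1 h p ->
  exists2 s, s != 0 & hc p = (s * (affine_vec h (coord1 h p)).1,
                              s * (affine_vec h (coord1 h p)).2).
Proof.
rewrite /hc; case: h => /= h0; [exists (hc0 p)|exists (hc1 p)] => //;
  by rewrite mulr1 mulrCA divff ?mulr1.
Qed.

Lemma ex_chart1 p : exists h, in_chart1 h p.
Proof.
by have := hc_neq0 p; rewrite pair_neq0 => /orP[]; [exists true|exists false].
Qed.

Lemma P1pt_chart h v (nv : v != 0) : (if h then v.1 else v.2) != 0 ->
  in_chart1 h (P1pt nv) /\
  coord1 h (P1pt nv) = if h then v.2 / v.1 else v.1 / v.2.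
Proof.
have [k k0 E] := P1pt_hc nv; move: E; set p := P1pt nv => E.
rewrite E; case: h => /=; rewrite mulf_eq0 (negPf k0) /= => p0;
  by split=> //; field; rewrite k0 p0.
Qed.

End Points.

(** * The involution along the fibres of a biquadratic curve *)

Lemma sum3 (V : nmodType) (f : 'I_3 -> V) :
  \sum_(i < 3) f i = f ord0 + f 1 + f ord_max.
Proof. by rewrite !big_ord_recr big_ord0 /= add0r; congr (f _ + f _ + f _); apply: val_inj. Qed.

Section BiquadraticCurve.
Variables (F : fieldType) (m : 'I_3 -> 'I_3 -> F).
Implicit Types (x y : P1 F) (v w : F * F) (P Q : P1 F * P1 F).

Definition coefY (j : 'I_3) v : F := \sum_(i < 3) m i j * v.1 ^+ i * v.2 ^+ (2 - i).

Definition fibre_form x w : F :=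
  qform (coefY ord_max (hc x)) (coefY 1 (hc x)) (coefY ord0 (hc x)) w.

Definition biquadratic_curve P : bool := fibre_form P.1 (hc P.2) == 0.
Local Notation curve := {P : P1 F * P1 F | biquadratic_curve P}.

(** The form on a fibre vanishes identically exactly when the line above
    that point is contained in the curve. *)
Definition no_vertical_line : Prop := forall v, v != 0 ->
  [|| coefY ord_max v != 0, coefY 1 v != 0 | coefY ord0 v != 0].

Lemma coefY_scale j s v : coefY j (s * v.1, s * v.2) = s ^+ 2 * coefY j v.
Proof. by rewrite /coefY !sum3 /=; ring. Qed.

(** y and y' are the two points, with multiplicity, of the fibre above x. *)
Definition conjugate x y y' : Prop :=
  splits (coefY ord_max (hc x)) (coefY 1 (hc x)) (coefY ord0 (hc x)) (hc y) (hc y').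

(** [conjugate] reads the representatives of its points chosen by the quotient;
    this lets it be checked on any homogeneous coordinates. *)
Lemma conjugate_P1pt x y u w w' (nw' : w' != 0) r s : r != 0 -> s != 0 ->
  hc x = (r * u.1, r * u.2) -> hc y = (s * w.1, s * w.2) ->
  splits (coefY ord_max u) (coefY 1 u) (coefY ord0 u) w w' ->
  conjugate x y (P1pt nw').
Proof.
move=> r0 s0 Ex Ey sp; have [k k0 Ew'] := P1pt_hc nw'.
rewrite /conjugate Ex Ey !coefY_scale.
have -> : hc (P1pt nw') = (k^-1 * w'.1, k^-1 * w'.2).
  by rewrite [w' in (_ * w'.1, _)]Ew' [w' in (_, _ * w'.2)]Ew' /= !mulKf.
by apply: splits_scale => //; rewrite ?expf_neq0 ?invr_eq0.
Qed.

Lemma conjugate_sym x y y' : conjugate x y y' -> conjugate x y' y.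
Proof. exact: splits_sym. Qed.

Lemma conjugate_uniq x y y' y'' : conjugate x y y' -> conjugate x y y'' -> y' = y''.
Proof. by move=> c' c''; apply: P1_eq; apply: (splits_uniq (hc_neq0 y) c' c''). Qed.

Lemma conjugate_curve x y y' : conjugate x y y' -> biquadratic_curve (x, y').
Proof. by move=> c; apply/eqP; apply: splits_qform c. Qed.

Hypothesis nl : no_vertical_line.

(** Homogeneous coordinates of the second point of the fibre, computed in the
    charts h of the first factor and g of the second. *)
Definition chart_residual (h g : bool) x y : F * F :=
  let u := affine_vec h (coord1 h x) in
  residual (coefY ord_max u) (coefY 1 u) (coefY ord0 u) g (affine_vec g (coord1 g y)).

Lemma affine_vec_neq0 h z : affine_vec h z != 0 :> F * F.
Proof. by rewrite pair_neq0; case: h; rewrite /= oner_neq0 ?orbT. Qed.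

Lemma conjugate_chart h g P : biquadratic_curve P -> in_chart (h, g) P ->
  exists nr : chart_residual h g P.1 P.2 != 0, conjugate P.1 P.2 (P1pt nr).
Proof.
move=> /eqP; rewrite /fibre_form => EP /andP[/= hP gP].
have [r r0 Er] := hc_chart hP; have [s s0 Es] := hc_chart gP.
pose u := affine_vec h (coord1 h P.1); pose w := affine_vec g (coord1 g P.2).
have q0 : qform (coefY ord_max u) (coefY 1 u) (coefY ord0 u) w = 0.
  (* passing to the representatives multiplies the equation by r^2 s^2 *)
  apply: (mulfI (mulf_neq0 (expf_neq0 2 r0) (expf_neq0 2 s0))).
  by rewrite mulr0 -EP Er Es !coefY_scale /qform /=; ring.
have sp : splits (coefY ord_max u) (coefY 1 u) (coefY ord0 u) w
            (chart_residual h g P.1 P.2).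
  by apply: splits_residual q0; rewrite /w; case: (g); rewrite oner_neq0.
have nr := splits_neq0 (nl (affine_vec_neq0 _ _)) sp.
by exists nr; apply: (conjugate_P1pt _ r0 s0 Er Es).
Qed.

Lemma ex_conjugate (P : curve) : exists y', conjugate (val P).1 (val P).2 y'.
Proof.
have [h hP] := ex_chart1 (val P).1; have [g gP] := ex_chart1 (val P).2.
have [|nr c] := @conjugate_chart h g _ (valP P); first exact/andP.
by exists (P1pt nr).
Qed.

Definition conjugate_of (P : curve) : P1 F := projT1 (cid (ex_conjugate P)).

Lemma conjugate_ofP (P : curve) : conjugate (val P).1 (val P).2 (conjugate_of P).
Proof. exact: projT2 (cid (ex_conjugate P)). Qed.

Definition fibre_involution (P : curve) : curve :=
  exist _ ((val P).1, conjugate_of P) (conjugate_curve (conjugate_ofP P)).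

Lemma fibre_involutionK : involutive fibre_involution.
Proof.
move=> P; apply: val_inj; rewrite [RHS]surjective_pairing /=; congr (_, _).
exact: (conjugate_uniq (conjugate_ofP (fibre_involution P))
          (conjugate_sym (conjugate_ofP P))).
Qed.

(** The fibre coefficients as polynomials in the coordinate of the chart h:
    passing to the chart at infinity reverses the exponents. *)
Definition coefY_poly (h : bool) (j : 'I_3) : {poly {poly F}} :=
  \sum_(i < 3) (m i j)%:P%:P * 'X ^+ (if h then 2 - i else i)%N.

Lemma coefY_polyE h j (z z' : F) :
  (coefY_poly h j).[z, z'] = coefY j (affine_vec h z).
Proof.
rewrite /coefY_poly /coefY !sum3.
by case: h; rewrite /= !hornerE /= ?expr1n /=; ring.
Qed.

Definition residual_poly (h g : bool) : {poly {poly F}} * {poly {poly F}} :=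
  if g then (coefY_poly h ord0,
             - (coefY_poly h 1 + coefY_poly h ord0 * 'Y))
  else (- (coefY_poly h 1 + coefY_poly h ord_max * 'Y),
        coefY_poly h ord_max).

Lemma residual_polyE h g P :
  (chart_eval (h, g) (residual_poly h g).1 P,
   chart_eval (h, g) (residual_poly h g).2 P) = chart_residual h g P.1 P.2.
Proof.
rewrite /chart_residual /residual_poly /residual /chart_eval /=.
by case: g; rewrite /= !hornerE /= !coefY_polyE /=; congr (_, _); ring.
Qed.

(** The residual root is a nonvanishing vector of polynomials in the chart
    coordinates around P.  The target chart g' is the one in which its
    denominator is nonzero at P, hence on a neighbourhood of P. *)
Lemma fibre_involution_endo : endomorphism fibre_involution.
Proof.
move=> P.
have [h hP] := ex_chart1 (val P).1; have [g gP] := ex_chart1 (val P).2.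
have hgP : in_chart (h, g) (val P) by apply/andP.
have key (Q : curve) (g' : bool) : in_chart (h, g) (val Q) ->
    (if g' then (chart_residual h g (val Q).1 (val Q).2).1
     else (chart_residual h g (val Q).1 (val Q).2).2) != 0 ->
    in_chart (h, g') (val (fibre_involution Q)) /\
    coord1 g' (conjugate_of Q) =
      let r := chart_residual h g (val Q).1 (val Q).2 in
      if g' then r.2 / r.1 else r.1 / r.2.
  move=> hgQ g'Q; have [nr c] := conjugate_chart (valP Q) hgQ.
  have E := conjugate_uniq (conjugate_ofP Q) c.
  have [in1 co1] := P1pt_chart nr g'Q.
  by rewrite /in_chart /= E co1 in1; case/andP: hgQ => /= ->.
have [g' g'P] : exists g' : bool,
    (if g' then (chart_residual h g (val P).1 (val P).2).1
     else (chart_residual h g (val P).1 (val P).2).2) != 0.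
  have [nr _] := conjugate_chart (valP P) hgP.
  by move: (nr); rewrite pair_neq0 => /orP[]; [exists true|exists false].
have [D DE] : exists D, forall Q, chart_eval (h, g) D Q =
    let r := chart_residual h g Q.1 Q.2 in if g' then r.1 else r.2.
  exists (let r := residual_poly h g in if g' then r.1 else r.2) => Q.
  by rewrite -residual_polyE; case: (g').
have [N NE] : exists N, forall Q, chart_eval (h, g) N Q =
    let r := chart_residual h g Q.1 Q.2 in if g' then r.2 else r.1.
  exists (let r := residual_poly h g in if g' then r.2 else r.1) => Q.
  by rewrite -residual_polyE; case: (g').
have e1 Q : chart_eval (h, g) 1 Q = 1 by rewrite /chart_eval !hornerE.
exists (h, g), (h, g'), 'X, 1, N, D; split=> //.
- by have [] := key P g' hgP g'P.
- by rewrite e1 oner_neq0.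
- by rewrite [chart_eval _ D _]DE.
move=> Q hgQ _; rewrite ![chart_eval _ D _]DE => DQ.
have [in1 co1] := key Q g' hgQ DQ.
split=> //; first by rewrite e1 divr1 /chart_eval /= !hornerE.
by rewrite /= co1 [chart_eval _ N _]NE; case: (g').
Qed.

Lemma fibre_involution_auto : automorphism fibre_involution.
Proof.
split; first exact: fibre_involution_endo.
exists fibre_involution.
by split; [exact: fibre_involution_endo|exact: fibre_involutionK..].
Qed.

(** Where a and y are nonzero, the product of the roots determines y'. *)
Lemma fibre_involutionE (P : curve) :
  hc0 (val P).2 != 0 -> hc1 (val P).2 != 0 -> coefY ord_max (hc (val P).1) != 0 ->
  val (fibre_involution P) =
    ((val P).1, P1affine (coefY ord0 (hc (val P).1) /
       (coefY ord_max (hc (val P).1) * (hc0 (val P).2 / hc1 (val P).2)))).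
Proof.
move=> y0 y1 a0 /=; congr (_, _).
apply: conjugate_uniq (conjugate_ofP P) _.
apply: (@conjugate_P1pt _ _ (hc (val P).1) (hc (val P).2) _ _ 1 1);
  rewrite ?oner_neq0 /hc /= ?mul1r //.
have /eqP := valP P; rewrite /fibre_form /qform /=.
move: (coefY ord0 _) (coefY 1 _) (coefY ord_max _) a0 => c b a a0 q0.
(* the second root is [c / (a y) : 1], so comparing leading terms gives k y1 = a *)
exists (a / hc1 (val P).2) => /=; first by rewrite mulf_neq0 ?invr_eq0.
split=> /=; [by field| |by field; rewrite a0 y0 y1].
apply: (mulfI (mulf_neq0 y0 y1)); apply/eqP; rewrite -subr_eq0 -[0]q0; apply/eqP.
by field; rewrite a0 y0 y1.
Qed.

(** A quadratic form has at most two zeros on P^1: if y is one of them, the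
    form splits at y, so that any zero is y or its residual root. *)
Lemma finite_quadric (a b c : F) : [|| a != 0, b != 0 | c != 0] ->
  finite_set [set y | qform a b c (hc y) = 0].
Proof.
move=> nz; have [->|/set0P[y qy]] := eqVneq [set y | qform a b c (hc y) = 0] set0.
  exact: finite_set0.
have [g gy] : exists g : bool, (if g then (hc y).1 else (hc y).2) != 0.
  by have [[] ?] := ex_chart1 y; [exists true|exists false].
have sp := splits_residual gy qy.
apply: (sub_finite_set (B := [set y; P1pt (splits_neq0 nz sp)])); last first.
  by rewrite finite_setU; split; exact: finite_set1.
move=> z /(splits_root sp) [E|E]; [left|right].
  exact: P1_eq.
by rewrite /= -(P1pt_hcK z); apply: P1pt_eq.
Qed.

Lemma finite_fibre x : finite_set [set y | biquadratic_curve (x, y)].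
Proof.
apply: sub_finite_set (finite_quadric (nl (hc_neq0 x))) => y /= /eqP; exact.
Qed.

Lemma finite_over (X : set (P1 F)) : finite_set X ->
  finite_set [set P : curve | X (val P).1].
Proof.
move=> Xfin.
have Bfin : finite_set (\bigcup_(x in X)
    ([set x] `*` [set y | biquadratic_curve (x, y)])).
  apply: bigcup_finite => // x _; apply: finite_setX; first exact: finite_set1.
  exact: finite_fibre.
have := finite_preimage (f := val : curve -> _) (in2W val_inj) Bfin.
apply: sub_finite_set => P XP; exists (val P).1 => //; split=> //=.
by rewrite -surjective_pairing; exact: valP.
Qed.

End BiquadraticCurve.

(** * Exchanging the two factors *)

Section Swap.
Variables (F : fieldType) (E : pred (P1 F * P1 F)).

Definition swapped : pred (P1 F * P1 F) := fun P => E (P.2, P.1).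

Definition to_swapped (P : {P | E P}) : {P | swapped P} :=
  exist _ ((val P).2, (val P).1)
    (eq_ind _ (fun Q => is_true (E Q)) (valP P) _ (surjective_pairing (val P))).

Definition of_swapped (P : {P | swapped P}) : {P | E P} :=
  exist _ ((val P).2, (val P).1) (valP P).

Lemma to_swappedK : cancel to_swapped of_swapped.
Proof. by move=> P; apply: val_inj; rewrite [RHS]surjective_pairing. Qed.

Lemma of_swappedK : cancel of_swapped to_swapped.
Proof. by move=> P; apply: val_inj; rewrite [RHS]surjective_pairing. Qed.

Definition swap_map (phi : {P | E P} -> {P | E P}) (P : {P | swapped P}) :=
  to_swapped (phi (of_swapped P)).

Lemma chart_eval_swap (c : bool * bool) (p : {poly {poly F}}) (P : P1 F * P1 F) :
  chart_eval (c.2, c.1) (swapXY p) P = chart_eval c p (P.2, P.1).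
Proof. exact: horner2_swapXY. Qed.

Lemma swap_map_endo phi : endomorphism phi -> endomorphism (swap_map phi).
Proof.
move=> ephi P.
have [c [c' [f1 [g1 [f2 [g2 [inP inphiP g1P g2P reg]]]]]]] := ephi (of_swapped P).
exists (c.2, c.1), (c'.2, c'.1), (swapXY f2), (swapXY g2), (swapXY f1), (swapXY g1).
split; rewrite ?chart_eval_swap //.
- by rewrite /in_chart /= andbC.
- by rewrite /in_chart /= andbC.
move=> Q inQ; rewrite !chart_eval_swap => g2Q g1Q.
have [||// |in1 e1 e2] := reg (of_swapped Q); [|done..|].
  by move: inQ; rewrite /in_chart /= andbC.
by split=> //; rewrite /in_chart /= andbC.
Qed.

Lemma swap_map_comp phi psi :
  cancel phi psi -> cancel (swap_map phi) (swap_map psi).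
Proof. by move=> K P; rewrite /swap_map to_swappedK K of_swappedK. Qed.

Lemma swap_map_auto phi : automorphism phi -> automorphism (swap_map phi).
Proof.
move=> [ephi [psi [epsi K1 K2]]]; split; first exact: swap_map_endo.
by exists (swap_map psi); split; [exact: swap_map_endo|exact: swap_map_comp..].
Qed.

Lemma finite_swapped (D : set {P | E P}) :
  finite_set D -> finite_set (of_swapped @^-1` D).
Proof. exact/finite_preimage/(in2W (can_inj of_swappedK)). Qed.

End Swap.

(** * Lines contained in the curve *)

(** Exchanging the two variables of a biquadratic form. *)
Definition transpose (T : Type) (m : 'I_3 -> 'I_3 -> T) i j := m j i.

Section Degeneracy.
Variable F : fieldType.
Implicit Type m : 'I_3 -> 'I_3 -> F.

Definition biquadratic_poly m : {poly {poly F}} :=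
  \sum_(i < 3) \sum_(j < 3) (m i j)%:P%:P * 'X ^+ i * 'Y ^+ j.


Lemma biquadratic_poly_transpose m :
  biquadratic_poly (transpose m) = swapXY (biquadratic_poly m).
Proof.
rewrite /biquadratic_poly exchange_big rmorph_sum; apply: eq_bigr => i _.
rewrite rmorph_sum; apply: eq_bigr => j _.
rewrite !rmorphM !rmorphXn /= swapXY_X swapXY_Y swapXY_polyC map_polyC /=.
by rewrite mulrAC.
Qed.

Lemma unit_swapXY (p : {poly {poly F}}) :
  (swapXY p \is a GRing.unit) = (p \is a GRing.unit).
Proof.
have imp (q : {poly {poly F}}) : q \is a GRing.unit -> swapXY q \is a GRing.unit.
  by move=> /unitrPr[r E]; apply/unitrPr; exists (swapXY r); rewrite -rmorphM E rmorph1.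
by apply/idP/idP => /imp //; rewrite swapXYK.
Qed.

Lemma degenerate_swapXY (p : {poly {poly F}}) :
  degenerate (swapXY p) -> degenerate p.
Proof.
case=> [[q [r [E nq nr]]]|szx|szy].
- apply: Or31; exists (swapXY q), (swapXY r).
  by rewrite !unit_swapXY -rmorphM /= -E swapXYK.
- by apply: Or33; rewrite sizeYE.
- by apply: Or32; rewrite sizeYE swapXYK in szy.
Qed.

(** A line over a finite point x gives the factor X - x of the polynomial; a
    line over infinity means that the coefficient of X^2 is zero. *)
Lemma vertical_line_degenerate m v : v != 0 ->
  coefY m ord_max v = 0 -> coefY m 1 v = 0 -> coefY m ord0 v = 0 ->
  degenerate (biquadratic_poly m).
Proof.
move=> v0 e2 e1 e0.
pose C i : {poly F} := \sum_(j < 3) (m i j)%:P * 'X ^+ j.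
have KE : biquadratic_poly m = \sum_(i < 3) (C i)%:P * 'X ^+ i.
  apply: eq_bigr => i _; rewrite rmorph_sum mulr_suml; apply: eq_bigr => j _.
  by rewrite rmorphM rmorphXn /= mulrAC.
have [v2|v2] := eqVneq v.2 0.
  have v1 : v.1 != 0 by move: v0; rewrite pair_neq0 v2 eqxx orbF.
  apply: Or32.
  have z j : coefY m j v = 0 -> m ord_max j = 0.
    rewrite /coefY sum3 v2 /= !expr0n /= !mulr0 !add0r mulr1 => /eqP.
    by rewrite mulf_eq0 expf_eq0 /= (negPf v1) orbF => /eqP.
  have C2 : C ord_max = 0 by rewrite /C sum3 !z // !mul0r !addr0.
  rewrite KE sum3 C2 mul0r addr0 /= expr0 mulr1 expr1 addrC size_MXaddC.
  by case: ifP => // _; rewrite ltnS size_polyC_leq1.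
pose x := v.1 / v.2.
have z j : coefY m j v = 0 -> coefY m j (x, 1) = 0.
  have -> : v = (v.2 * x, v.2 * 1).
    by rewrite mulr1 mulrCA divff // mulr1 -surjective_pairing.
  rewrite (coefY_scale m j v.2 (x, 1)) => /eqP.
  by rewrite mulf_eq0 expf_eq0 /= (negPf v2) => /eqP.
clearbody x; have rK : root (biquadratic_poly m) x%:P.
  apply/rootP; transitivity (\sum_(j < 3) (coefY m j (x, 1))%:P * 'X ^+ j).
    rewrite /biquadratic_poly /coefY !sum3 /= !hornerE /=.
    by rewrite -[(1 %% 3)%N]/1%N !rmorphD !rmorphM /=; ring.
  by rewrite sum3 !z // !mul0r !addr0.
have [r Er] := factor_theorem _ _ rK.
(* if the cofactor is a unit, the polynomial has degree 1 in X *)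
have [ur|nur] := boolP (r \is a GRing.unit); last first.
  apply: Or31; exists r, ('X - x%:P%:P); split=> //.
  by rewrite poly_unitE size_XsubC.
apply: Or32; rewrite Er; apply: leq_trans (size_polyMleq _ _) _.
by move: ur; rewrite poly_unitE size_XsubC => /andP[/eqP -> _].
Qed.

Lemma nondegenerate_no_vertical_line m :
  ~ degenerate (biquadratic_poly m) -> no_vertical_line m.
Proof.
move=> nd v v0; apply: contrapT => /negP.
rewrite !negb_or !negbK => /and3P[/eqP e2 /eqP e1 /eqP e0].
by apply: nd; apply: (vertical_line_degenerate v0).
Qed.

Lemma biquadratic_curve_transpose m :
  biquadratic_curve m = swapped (biquadratic_curve (transpose m)).
Proof.
apply/funext => P; rewrite /swapped /biquadratic_curve /fibre_form /qform.
by rewrite /coefY !sum3 /transpose /=; congr (_ == _); ring.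
Qed.

Lemma finite_over2 m (Y : set (P1 F)) : no_vertical_line (transpose m) ->
  finite_set Y ->
  finite_set [set P : {P | biquadratic_curve m P} | Y (val P).2].
Proof.
move=> nl Yfin; rewrite biquadratic_curve_transpose.
exact: finite_swapped (finite_over nl Yfin).
Qed.

(** Coefficients of X Y - s e(X, Y), the shape of the kernel. *)
Definition shifted_coef (s : F) (e : 'I_3 -> 'I_3 -> F) (i j : 'I_3) : F :=
  ((i == 1) && (j == 1))%:R - s * e i j.

Lemma biquadratic_poly_shifted s e :
  biquadratic_poly (shifted_coef s e) =
    'X * 'Y - s%:P%:P * \sum_(i < 3) \sum_(j < 3) (e i j)%:P%:P * 'X ^+ i * 'Y ^+ j.
Proof.
have -> : 'X * 'Y = \sum_(i < 3) \sum_(j < 3)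
    (((i == 1) && (j == 1))%:R : F)%:P%:P * 'X ^+ i * 'Y ^+ j.
  rewrite (bigD1 1) //= (bigD1 1) //= !big1 ?addr0 ?mul1r //.
    by move=> i /negPf i1; rewrite big1 // => j _; rewrite i1 /= !mul0r.
  by move=> j /negPf j1; rewrite j1 /= !mul0r.
rewrite mulr_sumr -sumrB; apply: eq_bigr => i _.
rewrite mulr_sumr -sumrB; apply: eq_bigr => j _.
by rewrite /shifted_coef !polyCB !polyCM !mulrBl !mulrA.
Qed.

End Degeneracy.

(** * The involutions of the kernel curve *)

Section Kernel.
Variables (R : realType) (d : 'I_3 -> 'I_3 -> R) (t : R).
Local Notation C := R[i].
Local Open Scope complex_scope.

Definition kernel_coef : 'I_3 -> 'I_3 -> C :=
  shifted_coef t%:C (fun i j => (d i j)%:C).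

Lemma kernel_biquadratic : kernel d t = biquadratic_poly kernel_coef.
Proof. by rewrite biquadratic_poly_shifted. Qed.

Lemma kernel_curve_biquadratic : kernel_curve d t = biquadratic_curve kernel_coef.
Proof.
apply/funext => P; rewrite /kernel_curve /biquadratic_curve; congr (_ == _).
rewrite /Kbar /fibre_form /qform /coefY /kernel_coef /shifted_coef !sum3 /=.
by ring.
Qed.

(** For j = 1 the term x y of the kernel would contribute as well; the other
    two coefficients are Laurent polynomials with denominators cleared. *)
Lemma coefY_kernel (p : P1 C) (j : 'I_3) : hc0 p != 0 -> hc1 p != 0 -> j != 1 ->
  coefY kernel_coef j (hc p) = - t%:C * (hc0 p * hc1 p) * A_ d j (Defs.ratio p).
Proof.
have step0 (z : C) : z ^ step ord0 = z^-1 by [].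
have step1 (z : C) : z ^ step 1 = 1 by [].
have step2 (z : C) : z ^ step ord_max = z by [].
move=> p0 p1 /negPf j1; rewrite /coefY /A_ /Defs.ratio !sum3 step0 step1 step2.
rewrite /kernel_coef /shifted_coef j1 !andbF -[nat_of_ord (1 : 'I_3)]/1%N /=.
by field; rewrite p0 p1.
Qed.

End Kernel.

Lemma kernel_coef_transpose (R : realType) (d : 'I_3 -> 'I_3 -> R) (t : R) :
  kernel_coef (transpose d) t = transpose (kernel_coef d t).
Proof.
apply/funext => i; apply/funext => j.
by rewrite /transpose /kernel_coef /shifted_coef andbC.
Qed.

Section KernelInvolution.
Variables (R : realType) (d : 'I_3 -> 'I_3 -> R) (t : R).
Hypotheses (t_neq0 : t != 0) (nondegenerate : ~ degenerate (kernel d t)).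
Local Notation m := (kernel_coef d t).

Lemma kernel_no_vertical_line : no_vertical_line m.
Proof. by apply: nondegenerate_no_vertical_line; rewrite -kernel_biquadratic. Qed.

Lemma kernel_no_horizontal_line : no_vertical_line (transpose m).
Proof.
apply: nondegenerate_no_vertical_line => dg; apply: nondegenerate.
by apply: degenerate_swapXY; rewrite kernel_biquadratic -biquadratic_poly_transpose.
Qed.

Lemma coefY_quadric (F : fieldType) (k : 'I_3 -> 'I_3 -> F) j v :
  coefY k j v = qform (k ord_max j) (k 1 j) (k ord0 j) v.
Proof. by rewrite /coefY sum3 /qform /=; ring. Qed.

(** The excluded points lie over 0, infinity and the zeros of A_1 in the first
    factor, or over 0 and infinity in the second.  A_1 is not zero because
    otherwise the curve would contain the line y = infinity. *)
Lemma finite_iota1_undefined :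
  finite_set [set P : {P | biquadratic_curve m P} | ~~ iota1_dom d (val P)].
Proof.
(* the form Y0 Y1 vanishes exactly at 0 and infinity *)
pose Z : set (P1 R[i]) := [set x | qform 0 1 0 (hc x) = 0].
pose L : set (P1 R[i]) := [set x | coefY m ord_max (hc x) = 0].
have Zfin : finite_set Z by apply: finite_quadric; rewrite oner_neq0 orbT.
have Lfin : finite_set L.
  rewrite /L; under eq_set do rewrite coefY_quadric; apply: finite_quadric.
  (* (1, 0) is the point at infinity of the second factor *)
  have := @kernel_no_horizontal_line (1, 0).
  rewrite /coefY !sum3 /= !expr0n !expr1n /= !mulr0 !add0r !mulr1.
  by apply; rewrite pair_neq0 oner_neq0.
have Z0 x : ~ Z x -> (hc0 x != 0) && (hc1 x != 0).
  move=> nZ; rewrite -negb_or -mulf_eq0; apply/eqP => z; apply: nZ.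
  by rewrite /Z /= /qform /= z mul0r mul0r mulr0 !addr0.
have ZLfin : finite_set (Z `|` L) by rewrite finite_setU.
have := finite_over kernel_no_vertical_line ZLfin.
have := finite_over2 kernel_no_horizontal_line Zfin.
move=> f2 f1; have : finite_set
    ([set P : {P | biquadratic_curve m P} | (Z `|` L) (val P).1] `|`
     [set P | Z (val P).2]) by rewrite finite_setU.
apply: sub_finite_set => P; apply: contraPP => /=.
move=> /not_orP[/not_orP[/Z0/andP[x0 x1] nL] /Z0/andP[y0 y1]].
apply/negP; rewrite negbK /iota1_dom /nonzero_coords x0 x1 y0 y1 /=.
apply/eqP => A0; apply: nL; rewrite /L /= coefY_kernel //.
by rewrite A0 mulr0.
Qed.

Lemma fibre_involution_iota1 (P : {P | biquadratic_curve m P}) :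
  iota1_dom d (val P) ->
  val (fibre_involution kernel_no_vertical_line P) = iota1 d (val P).
Proof.
move=> /andP[/and4P[x0 x1 y0 y1] A0].
have t0 : t%:C%C != 0 :> R[i] by rewrite fmorph_eq0.
have a0 : coefY m ord_max (hc (val P).1) != 0.
  by rewrite coefY_kernel // !mulf_neq0 ?oppr_eq0.
rewrite (fibre_involutionE _ y0 y1 a0) /iota1 !coefY_kernel //.
congr (_, P1affine _); rewrite /Defs.ratio.
by field; apply/and5P; split=> //; apply/andP.
Qed.

Theorem kernel_involution1 :
  exists phi : {P | kernel_curve d t P} -> {P | kernel_curve d t P},
    [/\ automorphism phi, involutive phi &
        extends_rational_map phi (iota1_dom d) (iota1 d)].
Proof.
rewrite kernel_curve_biquadratic; exists (fibre_involution kernel_no_vertical_line).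
split; [exact: fibre_involution_auto|exact: fibre_involutionK|].
by split; [exact: finite_iota1_undefined|exact: fibre_involution_iota1].
Qed.

End KernelInvolution.

Theorem proposition3p1 (R : realType) (d : 'I_3 -> 'I_3 -> R) (t : R)
    (d_range : forall i j, 0 <= d i j <= 1)
    (d_sum : \sum_(i < 3) \sum_(j < 3) d i j = 1)
    (t_range : 0 < t < 1)
    (t_trans :
      transcendental_over (subfield_gen [set d ij.1 ij.2 | ij in [set: 'I_3 * 'I_3]]) t)
    (nondegenerate : ~ degenerate (kernel d t)) :
  (exists phi : {P : P1 R[i] * P1 R[i] | kernel_curve d t P} ->
                {P : P1 R[i] * P1 R[i] | kernel_curve d t P},
     [/\ automorphism phi, involutive phi &
         extends_rational_map phi (iota1_dom d) (iota1 d)]) /\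
  (exists phi : {P : P1 R[i] * P1 R[i] | kernel_curve d t P} ->
                {P : P1 R[i] * P1 R[i] | kernel_curve d t P},
     [/\ automorphism phi, involutive phi &
         extends_rational_map phi (iota2_dom d) (iota2 d)]).
Proof.
have t0 : t != 0 by case/andP: t_range => /lt0r_neq0.
split; first exact: kernel_involution1.
have nondegenerateT : ~ degenerate (kernel (transpose d) t).
  rewrite kernel_biquadratic kernel_coef_transpose biquadratic_poly_transpose.
  by rewrite -kernel_biquadratic => /degenerate_swapXY.
have [phi [aphi iphi [fin ext]]] := kernel_involution1 t0 nondegenerateT.
have -> : kernel_curve d t = swapped (kernel_curve (transpose d) t).
  by rewrite !kernel_curve_biquadratic kernel_coef_transpose
    -biquadratic_curve_transpose.
have domE P : iota2_dom d P = iota1_dom (transpose d) (P.2, P.1).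
  rewrite /iota2_dom /iota1_dom /nonzero_coords /=; congr (_ && _).
  by rewrite andbA andbC -andbA.
exists (swap_map phi); split; [exact: swap_map_auto|exact: swap_map_comp|split].
  by under eq_set do rewrite domE; exact: finite_swapped fin.
by move=> P; rewrite domE => /(ext (of_swapped P)) E; rewrite /= E.
Qed.
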